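(* Let $I\in\mathcal N(u,v)$ and $J\in\mathcal P$ be such that $I\oplus J$ consists of a single augmenting path between $u$ and $v$, containing $k$ edges of $I$ and $k+1$ edges of $J$. Then there is a routing $\theta_{I,J}$ from $I$ to $J$ such that $$\mathsf{En}(\theta_{I,J})=O(\log(k+2)),$$ with a universal implied constant.
   Context: Let $V_1,V_2$ be disjoint sets with $|V_1|=|V_2|=n$. In the complete bipartite graph on $(V_1,V_2)$, $\mathcal P$ is the set of perfect matchings and $\mathcal N(u,v)$, for $(u,v)\in V_1\times V_2$, is the set of matchings with $n-1$ edges leaving exactly $u$ and $v$ unmatched; $\Omega=\mathcal P\cup\bigcup_{u,v}\mathcal N(u,v)$. $I\oplus J$ is symmetric difference of edge sets. The transition graph on $\Omega$ (edge set $\mathcal T$) has the following undirected edges: add/delete: $M\in\mathcal P$ and $M\setminus\{(u,v)\}$ for $(u,v)\in M$; slides: $M\in\mathcal N(u,v)$ and, for each $(x,y)\in M$, $M\setminus\{(x,y)\}\cup\{(x,v)\}\in\mathcal N(u,y)$ and $M\setminus\{(x,y)\}\cup\{(u,y)\}\in\mathcal N(x,v)$. A routing from $I$ to $J$ is a probability distribution $\theta$ on the set of paths from $I$ to $J$ in the transition graph with no repeated vertices; its energy is $\mathsf{En}(\theta)=\sum_{e\in\mathcal T}\Pr_{\gamma\sim\theta}[e\in\gamma]^2$. *)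

(* Defs.v *)
From HB Require Import structures.
From mathcomp Require Import all_boot all_order all_algebra.
From mathcomp Require Import reals exp.

Set Implicit Arguments.
Unset Strict Implicit.
Unset Printing Implicit Defensive.

Import Order.TTheory GRing.Theory Num.Theory.

Local Open Scope ring_scope.

Section Matchings.

Variables V1 V2 : finType.

(* Every pair is an edge of the complete bipartite graph on (V1, V2). *)
Local Notation edge := (V1 * V2)%type.

Definition matching (M : {set edge}) : bool :=
  [forall e in M, forall f in M,
     ((e.1 == f.1) || (e.2 == f.2)) ==> (e == f)].

Definition unmatched1 (M : {set edge}) : {set V1} :=
  [set x | [forall y, (x, y) \notin M]].

Definition unmatched2 (M : {set edge}) : {set V2} :=
  [set y | [forall x, (x, y) \notin M]].

Definition perfect : {set {set edge}} :=
  [set M | [&& matching M, unmatched1 M == set0 & unmatched2 M == set0]].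

Definition near_perfect (u : V1) (v : V2) : {set {set edge}} :=
  [set M | [&& matching M, #|M| == #|V1|.-1,
               unmatched1 M == [set u] & unmatched2 M == [set v]]].

Definition Omega : {set {set edge}} :=
  perfect :|: \bigcup_(u : V1) \bigcup_(v : V2) near_perfect u v.

Definition symdiff (A B : {set edge}) : {set edge} := (A :\: B) :|: (B :\: A).

(* [P] is the edge set of the path x_0 y_0 x_1 y_1 ... x_m y_m from u = x_0 to
   v = y_m, which is augmenting for M: its endpoints are unmatched and its
   edges are alternately outside and inside M.  Only the values of [x] and [y]
   at indices at most m are relevant. *)
Definition augmenting_path (M P : {set edge}) (u : V1) (v : V2) : Prop :=
  exists (m : nat) (x : nat -> V1) (y : nat -> V2),
    [/\ {in [pred i | (i <= m)%N] &, injective x},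
        {in [pred i | (i <= m)%N] &, injective y},
        x 0%N = u /\ y m = v,
        u \in unmatched1 M /\ v \in unmatched2 M &
        [/\ forall i, (i <= m)%N -> (x i, y i) \notin M,
            forall i, (i < m)%N -> (x i.+1, y i) \in M &
            P = [set (x i, y i) | i : 'I_m.+1]
                  :|: [set (x i.+1, y i) | i : 'I_m]]].

Definition delete_move (M M' : {set edge}) : bool :=
  (M \in perfect) && [exists e in M, M' == M :\ e].

Definition slide_move (M M' : {set edge}) : bool :=
  [exists u, exists v, (M \in near_perfect u v) &&
    [exists e in M, (M' == (e.1, v) |: (M :\ e))
                 || (M' == (u, e.2) |: (M :\ e))]].

(* Undirected edges are unordered pairs [set M; M'], so listing each move in
   one direction suffices. *)
Definition transitions : {set {set {set edge}}} :=
  [set [set p.1; p.2] | p in setX Omega Omega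
                      & delete_move p.1 p.2 || slide_move p.1 p.2].

Definition adjacent (M M' : {set edge}) : bool :=
  [set M; M'] \in transitions.

Definition simple_path (I J : {set edge}) (g : seq {set edge}) : bool :=
  if g is M :: p
  then [&& M == I, path adjacent M p, last M p == J & uniq g]
  else false.

(* Sequences without repetition have at most #|{set edge}| terms, so the length
   bound excludes no path; it makes the type finite. *)
Definition spath (I J : {set edge}) : Type :=
  {g : #|{: {set edge}}|.-bseq {set edge} | simple_path I J g}.
HB.instance Definition _ I J := Finite.on (spath I J).

Definition path_edges (g : seq {set edge}) : seq {set {set edge}} :=
  [seq [set p.1; p.2] | p <- zip g (behead g)].

Section Routing.

Variables (R : realType) (I J : {set edge}).

Definition is_routing (theta : {ffun spath I J -> R}) : Prop :=
  (forall g, 0 <= theta g) /\ \sum_g theta g = 1.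

Definition energy (theta : {ffun spath I J -> R}) : R :=
  \sum_(e in transitions)
    (\sum_(g : spath I J | e \in path_edges (val g)) theta g) ^+ 2.

End Routing.

End Matchings.

(* Main.v *)
(** Write the augmenting path as x_0 y_0 x_1 ... x_m y_m, with (x_i, y_i) in J
and (x_(i+1), y_i) in I.  Sliding a times at the left end of I and m - b times
at the right end leads to a near-perfect matching with unmatched vertices x_a
and y_b, so the reachable states form a triangular grid 0 <= a <= b <= m; adding
(x_a, y_a) to the state (a, a) yields J.  The routing picks c in {0, ..., m}
uniformly and follows the straight line from (0, m) to (c, c), being at time t
in the state with a = floor (c t / m) and t slides made in all.  A state at
time t > 0 lies on at most 3 m / t of the m + 1 lines, so that every edge left
at time t has probability at most 3 / t.  As the probabilities of these edges
sum to 1, time t contributes at most 3 / t to the energy, and the harmonic sum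
is logarithmic. *)

Require Import Defs.
From mathcomp Require Import all_boot all_order all_algebra.
From mathcomp Require Import reals exp.
From mathcomp Require Import zify lra.

Set Implicit Arguments.
Unset Strict Implicit.
Unset Printing Implicit Defensive.

Import Order.TTheory GRing.Theory Num.Theory.

Local Open Scope ring_scope.

(** * Energy of a uniform mixture of layered paths *)

Section UniformRouting.

Variables (V1 V2 : finType) (R : realType) (I J : {set V1 * V2}) (N L : nat).
Variable s : 'I_N.+1 -> nat -> {set V1 * V2}.

Lemma path_edges_map_iota (T : nat -> {set V1 * V2}) (a k : nat) :
  path_edges (map T (iota a k.+1)) =
  [seq [set T t; T t.+1] | t <- iota a k].
Proof.
elim: k a => [|k IHk] a //.
by have := IHk a.+1; rewrite /path_edges /= => <-.
Qed.

Lemma path_adjacent_map_iota (T : nat -> {set V1 * V2}) (a k : nat) :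
  (forall t, (a <= t < a + k)%N -> adjacent (T t) (T t.+1)) ->
  path (@adjacent V1 V2) (T a) (map T (iota a.+1 k)).
Proof.
elim: k a => [//|k IHk] a adjT /=.
rewrite adjT ?IHk //; first by move=> t /andP[? ?]; apply: adjT; lia.
by lia.
Qed.

Hypotheses (s0 : forall c, s c 0 = I) (sL : forall c, s c L = J).
Hypothesis s_adj : forall c t, (t < L)%N -> adjacent (s c t) (s c t.+1).
(** With [c = c'] this keeps each path free of repetitions; across paths it ties every edge to a
    single time. *)
Hypothesis s_layer : forall c c' t t',
  (t <= L)%N -> (t' <= L)%N -> s c t = s c' t' -> t = t'.

Let seqp c := map (s c) (iota 0 L.+1).

Lemma simple_path_layers c : simple_path I J (seqp c).
Proof.
rewrite /simple_path /seqp.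
have -> : iota 0 L.+1 = 0%N :: iota 1 L by [].
rewrite -[map _ _]/(s c 0 :: map (s c) (iota 1 L)) s0 eqxx /= -{1}(s0 c).
rewrite path_adjacent_map_iota /=; last by move=> t lt_t; apply: s_adj; lia.
have -> : last I (map (s c) (iota 1 L)) = s c L.
  rewrite -(s0 c) last_map; congr (s c _).
  by case: (L) => [//|l]; rewrite -(addn1 l) iotaD cats1 last_rcons addnC.
rewrite sL eqxx /= -{1}(s0 c) -[_ && _]/(uniq (map (s c) (iota 0 L.+1))).
rewrite map_inj_in_uniq ?iota_uniq // => t t'.
by rewrite !mem_iota !add0n !ltnS => /= lt_t lt_t' /s_layer ->.
Qed.

Lemma size_layers c : (size (seqp c) <= #|{: {set V1 * V2}}|)%N.
Proof.
have := simple_path_layers c; rewrite /simple_path.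
case: (seqp c) => [//|M p] /and4P[_ _ _ /card_uniqP <-].
exact: max_card.
Qed.

Definition layer_path c : spath I J :=
  exist _ (Bseq (size_layers c)) (simple_path_layers c).

(** A sum of indicators, so that indices with the same path add up their weights. *)
Definition uniform_routing : {ffun spath I J -> R} :=
  [ffun g => \sum_c (layer_path c == g)%:R / N.+1%:R].

Lemma uniform_routing_is_routing : is_routing uniform_routing.
Proof.
split=> [g|].
  by rewrite ffunE sumr_ge0 // => c _; rewrite divr_ge0.
under eq_bigr do rewrite ffunE.
rewrite exchange_big /=.
under eq_bigr => c _.
  rewrite -mulr_suml (bigD1 (layer_path c)) //= eqxx big1 ?addr0; last first.
    by move=> g /negbTE; rewrite eq_sym => ->.
  over.
by rewrite sumr_const card_ord mul1r -[LHS]mulr_natl divff ?pnatr_eq0.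
Qed.

Let edge_prob e : R :=
  \sum_(g : spath I J | e \in path_edges (val g)) uniform_routing g.

Lemma edge_probE e :
  edge_prob e = \sum_c (e \in path_edges (seqp c))%:R / N.+1%:R.
Proof.
rewrite /edge_prob; under eq_bigr do rewrite ffunE.
rewrite exchange_big /=; apply: eq_bigr => c _.
rewrite -mulr_suml; congr (_ / _).
rewrite big_mkcond (bigD1 (layer_path c)) //= eqxx big1 ?addr0; last first.
  by move=> g /negbTE; rewrite eq_sym => ->; rewrite if_same.
by case: (e \in _).
Qed.

(** A path containing the [t]-th edge of path [c] can only traverse it at time [t], and so passes
    through [s c t] at that time. *)
Lemma edge_prob_layer c t : (t < L)%N ->
  edge_prob [set s c t; s c t.+1] <=
  #|[set c' | s c' t == s c t]|%:R / N.+1%:R.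
Proof.
move=> ltL; rewrite edge_probE -mulr_suml ler_wpM2r ?invr_ge0 //.
rewrite -sum1_card natr_sum [leRHS]big_mkcond ler_sum // => c' _.
rewrite inE; case: ifP => [_|/negP neq]; first by case: (_ \in _).
case: (boolP (_ \in _)) => // /[!path_edges_map_iota] /mapP[t'].
rewrite mem_iota add0n => /= lt' eq_e; case: neq; apply/eqP.
have /set2P[] : s c t \in [set s c' t'; s c' t'.+1] by rewrite -eq_e set21.
  by move=> E; rewrite E; congr (s c' _); apply: s_layer E; lia.
(* Traversal in the opposite direction would start at time [t - 1], which leaves no layer for the
   endpoint [s c t.+1]. *)
move=> E; have Et : t = t'.+1 by apply: s_layer E; lia.
move: ltL eq_e {E}; rewrite {t}Et => ltL eq_e.
have /set2P[] : s c t'.+2 \in [set s c' t'; s c' t'.+1] by rewrite -eq_e set22.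
by move=> /s_layer; lia.
by move=> /s_layer; lia.
Qed.

(* Replacing one factor of [Pr(e) ^+ 2] by the sum over [c] and [t] of the
   indicators of [e] being the t-th edge of path [c] leaves the average over [c]
   of the sum over [t] of [Pr] at that t-th edge. *)
Lemma energy_uniform_routing (b : nat -> R) :
  (forall c t, (t < L)%N -> #|[set c' | s c' t == s c t]|%:R <= b t * N.+1%:R) ->
  energy uniform_routing <= \sum_(t < L) b t.
Proof.
move=> leb.
have p_ge0 e : 0 <= edge_prob e.
  by rewrite edge_probE sumr_ge0 // => c _; rewrite divr_ge0.
have le1 e : edge_prob e <=
    \sum_c (\sum_(t < L) ([set s c t; s c t.+1] == e)%:R) / N.+1%:R.
  rewrite edge_probE ler_sum // => c _; rewrite ler_wpM2r ?invr_ge0 //.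
  case: (boolP (_ \in _)) => [|_]; last by rewrite sumr_ge0.
  rewrite path_edges_map_iota => /mapP[t]; rewrite mem_iota add0n => /= ltL ->.
  by rewrite (bigD1 (Ordinal ltL)) //= eqxx lerDl sumr_ge0.
(* Enlarging the range from [transitions] to all [e] only adds nonnegative terms. *)
apply: (@le_trans _ _ (\sum_e edge_prob e *
    \sum_c (\sum_(t < L) ([set s c t; s c t.+1] == e)%:R) / N.+1%:R)).
  rewrite /energy big_mkcond ler_sum // => e _.
  case: ifP => _; last first.
    by rewrite mulr_ge0 // sumr_ge0 // => c _; rewrite divr_ge0 // sumr_ge0.
  rewrite -[(\sum_(g | _) _)]/(edge_prob e) expr2.
  by apply: ler_wpM2l; rewrite ?p_ge0 ?le1.
under eq_bigr do rewrite mulr_sumr.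
rewrite exchange_big /=.
apply: (@le_trans _ _ (\sum_(c < N.+1) (\sum_(t < L) b t) / N.+1%:R)); last first.
  by rewrite sumr_const card_ord -mulrnAl -mulr_natr mulfK ?pnatr_eq0.
rewrite ler_sum // => c _.
under eq_bigr do rewrite mulrA mulr_sumr.
rewrite -mulr_suml ler_wpM2r ?invr_ge0 // exchange_big /=.
rewrite ler_sum // => t _.
rewrite (bigD1 [set s c t; s c t.+1]) //= eqxx mulr1 big1 ?addr0; last first.
  by move=> e /negbTE; rewrite eq_sym => ->; rewrite mulr0.
apply: le_trans (edge_prob_layer _ (ltn_ord t)) _.
by rewrite ler_pdivrMr ?ltr0n // leb.
Qed.

End UniformRouting.

(** * Two numerical estimates: lines through a grid point, and the harmonic sum *)

(** The condition means [q * m <= c * t < q.+1 * m], so [c] ranges over an interval of length m / t.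
    With its left end rounded down to [lo], it holds at most [(m %/ t).+2] integers; multiplying by
    [t] gives at most m + 2 t, hence the constant 3. *)
Lemma card_divn_fiber (m t q : nat) : (0 < t <= m)%N ->
  (#|[set c : 'I_m.+1 | (c * t) %/ m == q]| * t <= 3 * m)%N.
Proof.
move=> /andP[t_gt0 le_tm].
have m_gt0 : (0 < m)%N by lia.
set A := [set _ | _]; pose lo := (q * m %/ t)%N.
have bnd (c : 'I_m.+1) : c \in A -> (lo <= c < lo + (m %/ t).+2)%N.
  rewrite inE => /eqP def_q.
  have := divn_eq (c * t) m; have := ltn_pmod (c * t) m_gt0; rewrite def_q.
  have := divn_eq (q * m) t; have := ltn_pmod (q * m) t_gt0; rewrite -/lo.
  have := divn_eq m t; have := ltn_pmod m t_gt0.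
  by nia.
have cardA : (#|A| <= (m %/ t).+2)%N.
  have inj_f :
      {in A &, injective (fun c : 'I_m.+1 => inord (c - lo) : 'I_(m %/ t).+2)}.
    move=> c d /bnd bc /bnd bd /(congr1 val); rewrite /= !inordK; try lia.
    by move=> ?; apply/val_inj => /=; lia.
  by rewrite -(card_in_imset inj_f) -[leqRHS]card_ord max_card.
have := leq_mul2r t #|A| (m %/ t).+2; rewrite cardA orbT => le1.
apply: leq_trans le1 _; have := leq_trunc_div m t; lia.
Qed.

(** By induction: ln (1 - z) <= - z at z = 1 / (m + 2) bounds 1 / (m + 2) by the increment of the
    logarithm, and the factor 2 absorbs the passage from 1 / (m + 1) to 1 / (m + 2). *)
Lemma sum_inv_le_ln (R : realType) (m : nat) :
  \sum_(t < m) (t.+1%:R)^-1 <= 2 * ln m.+1%:R :> R.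
Proof.
elim: m => [|m IHm]; first by rewrite big_ord0 ln1 mulr0.
rewrite big_ord_recr /=.
have : ln (1 - (m.+2%:R)^-1) <= - (m.+2%:R)^-1 :> R.
  by apply: le_ln1Dx; rewrite ltrN2 invf_lt1 // ltr1n.
have -> : 1 - (m.+2%:R)^-1 = m.+1%:R / m.+2%:R :> R.
  rewrite -[X in X - _](@divff _ (m.+2%:R : R)) ?pnatr_eq0 //.
  by rewrite -[in RHS]natr1 -mulN1r -mulrDl -[m.+2]addn1 natrD addrK -natr1.
rewrite ln_div ?posrE ?ltr0n //.
have : (m.+1%:R)^-1 <= 2 * (m.+2%:R)^-1 :> R.
  rewrite ler_pdivlMr ?ltr0n // mulrC ler_pdivrMr ?ltr0n //.
  by rewrite -natrM ler_nat; lia.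
move: IHm; move: (\sum_(_ < m) _) (ln m.+1%:R) (ln m.+2%:R).
move: (m.+1%:R)^-1 (m.+2%:R)^-1.
by move=> S a b c d; lra.
Qed.

(** * Moves between near-perfect and perfect matchings *)

Section Slides.

Variables V1 V2 : finType.
Implicit Types M : {set V1 * V2}.

Lemma matchingP M :
  reflect {in M &, forall e f, e.1 = f.1 \/ e.2 = f.2 -> e = f} (matching M).
Proof.
apply: (iffP forall_inP) => [H e f eM fM E | H e eM].
  apply/eqP/(implyP (forall_inP (H e eM) f fM)); apply/orP.
  by case: E => ->; rewrite eqxx; auto.
apply/forall_inP => f fM; apply/implyP => /orP[]/eqP E; apply/eqP/H => //.
  by left.
by right.
Qed.

Lemma unmatched1P M (p : V1) :
  reflect (exists q, (p, q) \in M) (p \notin unmatched1 M).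
Proof.
rewrite inE negb_forall; apply: (iffP existsP) => -[q pqM]; exists q.
  by rewrite negbK in pqM.
by rewrite negbK.
Qed.

Lemma unmatched2P M (q : V2) :
  reflect (exists p, (p, q) \in M) (q \notin unmatched2 M).
Proof.
rewrite inE negb_forall; apply: (iffP existsP) => -[p pqM]; exists p.
  by rewrite negbK in pqM.
by rewrite negbK.
Qed.

(** The slide re-matches [q] from [p] to the free vertex [u]. Once [(p, q)] is removed nothing else
    covers [q], so the new edge meets no remaining one. *)
Lemma near_perfect_slide1 M u v p q :
  M \in near_perfect u v -> (p, q) \in M ->
  (u, q) |: M :\ (p, q) \in near_perfect p v.
Proof.
rewrite !inE => /and4P[/matchingP mM /eqP cM /eqP u1 /eqP u2] pqM.
have noU z : (u, z) \notin M.
  by have := set11 u; rewrite -u1 inE => /forallP.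
have noV z : (z, v) \notin M.
  by have := set11 v; rewrite -u2 inE => /forallP.
have neq_pu : p <> u by move=> E; have := noU q; rewrite -E pqM.
have neq_qv : q <> v by move=> E; have := noV p; rewrite -E pqM.
apply/and4P; split.
- apply/matchingP => -[a b] [c d].
  move=> /setU1P[[-> ->]|/setD1P[ne1 in1]] /setU1P[[-> ->]|/setD1P[ne2 in2]] //=.
  + case=> E; subst; first by have := noU d; rewrite in2.
    by rewrite (mM _ _ in2 pqM (or_intror _)) ?eqxx in ne2.
  + case=> E; subst; first by have := noU b; rewrite in1.
    by rewrite (mM _ _ in1 pqM (or_intror _)) ?eqxx in ne1.
  + by move=> E; apply: mM.
- by rewrite cardsU1 !inE (negPf (noU q)) andbF -cM (cardsD1 (p, q) M) pqM.
- apply/eqP/setP => r; rewrite in_set1; apply/idP/eqP => [|->].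
    apply: contraTeq => neq_rp; apply/unmatched1P.
    have [->|neq_ru] := eqVneq r u; first by exists q; rewrite setU11.
    have : r \notin unmatched1 M by rewrite u1 in_set1.
    move=> /unmatched1P[z rz]; exists z; rewrite !inE rz andbT; apply/orP; right.
    by apply: contraNneq neq_rp => -[->].
  rewrite inE; apply/forallP => z; apply/negP => /setU1P[[]//|/setD1P[ne1 in1]].
  by rewrite (mM _ _ in1 pqM (or_introl _)) ?eqxx in ne1.
- apply/eqP/setP => r; rewrite in_set1; apply/idP/eqP => [|->].
    apply: contraTeq => neq_rv; apply/unmatched2P.
    have [->|neq_rq] := eqVneq r q; first by exists u; rewrite setU11.
    have : r \notin unmatched2 M by rewrite u2 in_set1.
    move=> /unmatched2P[z rz]; exists z; rewrite !inE rz andbT; apply/orP; right.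
    by apply: contraNneq neq_rq => -[_ ->].
  rewrite inE; apply/forallP => z; apply/negP => /setU1P[[_ E]|/setD1P[_ in1]].
    by case: neq_qv.
  by have := noV z; rewrite in1.
Qed.

(** The mirror image: [p] is re-matched from [q] to the free vertex [v]. *)
Lemma near_perfect_slide2 M u v p q :
  M \in near_perfect u v -> (p, q) \in M ->
  (p, v) |: M :\ (p, q) \in near_perfect u q.
Proof.
rewrite !inE => /and4P[/matchingP mM /eqP cM /eqP u1 /eqP u2] pqM.
have noU z : (u, z) \notin M.
  by have := set11 u; rewrite -u1 inE => /forallP.
have noV z : (z, v) \notin M.
  by have := set11 v; rewrite -u2 inE => /forallP.
have neq_pu : p <> u by move=> E; have := noU q; rewrite -E pqM.
have neq_qv : q <> v by move=> E; have := noV p; rewrite -E pqM.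
apply/and4P; split.
- apply/matchingP => -[a b] [c d].
  move=> /setU1P[[-> ->]|/setD1P[ne1 in1]] /setU1P[[-> ->]|/setD1P[ne2 in2]] //=.
  + case=> E; subst; last by have := noV c; rewrite in2.
    by rewrite (mM _ _ in2 pqM (or_introl _)) ?eqxx in ne2.
  + case=> E; subst; last by have := noV a; rewrite in1.
    by rewrite (mM _ _ in1 pqM (or_introl _)) ?eqxx in ne1.
  + by move=> E; apply: mM.
- by rewrite cardsU1 !inE (negPf (noV p)) andbF -cM (cardsD1 (p, q) M) pqM.
- apply/eqP/setP => r; rewrite in_set1; apply/idP/eqP => [|->].
    apply: contraTeq => neq_ru; apply/unmatched1P.
    have [->|neq_rp] := eqVneq r p; first by exists v; rewrite setU11.
    have : r \notin unmatched1 M by rewrite u1 in_set1.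
    move=> /unmatched1P[z rz]; exists z; rewrite !inE rz andbT; apply/orP; right.
    by apply: contraNneq neq_rp => -[->].
  rewrite inE; apply/forallP => z; apply/negP => /setU1P[[E _]|/setD1P[_ in1]].
    by case: neq_pu.
  by have := noU z; rewrite in1.
- apply/eqP/setP => r; rewrite in_set1; apply/idP/eqP => [|->].
    apply: contraTeq => neq_rq; apply/unmatched2P.
    have [->|neq_rv] := eqVneq r v; first by exists p; rewrite setU11.
    have : r \notin unmatched2 M by rewrite u2 in_set1.
    move=> /unmatched2P[z rz]; exists z; rewrite !inE rz andbT; apply/orP; right.
    by apply: contraNneq neq_rq => -[_ ->].
  rewrite inE; apply/forallP => z; apply/negP => /setU1P[[]//|/setD1P[ne1 in1]].
  by rewrite (mM _ _ in1 pqM (or_intror _)) ?eqxx in ne1.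
Qed.

Lemma near_perfect_Omega M u v : M \in near_perfect u v -> M \in Omega V1 V2.
Proof.
move=> MN; rewrite inE; apply/orP; right.
by apply/bigcupP; exists u => //; apply/bigcupP; exists v.
Qed.

Lemma adjacent_slide1 M u v p q :
  M \in near_perfect u v -> (p, q) \in M ->
  adjacent M ((u, q) |: M :\ (p, q)).
Proof.
move=> MN pqM; apply/imsetP; exists (M, (u, q) |: M :\ (p, q)) => //.
rewrite 2!inE /= (near_perfect_Omega MN).
rewrite (near_perfect_Omega (near_perfect_slide1 MN pqM)) /=.
apply/orP; right; apply/existsP; exists u; apply/existsP; exists v.
by rewrite MN; apply/exists_inP; exists (p, q); rewrite ?eqxx ?orbT.
Qed.

Lemma adjacent_slide2 M u v p q :
  M \in near_perfect u v -> (p, q) \in M ->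
  adjacent M ((p, v) |: M :\ (p, q)).
Proof.
move=> MN pqM; apply/imsetP; exists (M, (p, v) |: M :\ (p, q)) => //.
rewrite 2!inE /= (near_perfect_Omega MN).
rewrite (near_perfect_Omega (near_perfect_slide2 MN pqM)) /=.
apply/orP; right; apply/existsP; exists u; apply/existsP; exists v.
by rewrite MN; apply/exists_inP; exists (p, q); rewrite ?eqxx ?orbT.
Qed.

Lemma adjacent_add M u v e :
  M \in perfect V1 V2 -> e \in M -> M :\ e \in near_perfect u v ->
  adjacent (M :\ e) M.
Proof.
move=> MP eM MN; apply/imsetP; exists (M, M :\ e); last by rewrite setUC.
rewrite 2!inE /= (near_perfect_Omega MN) inE MP /=.
by apply/orP; left; rewrite /delete_move MP; apply/exists_inP; exists e.
Qed.

(** Allows the grid coordinates of a state to be read off from its unmatched vertices. *)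
Lemma near_perfect_inj M u v u' v' :
  M \in near_perfect u v -> M \in near_perfect u' v' -> u = u' /\ v = v'.
Proof.
rewrite !inE => /and4P[_ _ /eqP -> /eqP ->].
move=> /and4P[_ _ /eqP/set1_inj -> /eqP/set1_inj ->].
by [].
Qed.

Lemma near_perfect_not_perfect M u v :
  M \in near_perfect u v -> M \notin perfect V1 V2.
Proof.
rewrite !inE => /and4P[_ _ /eqP -> _]; apply/negP => /and3P[_ /eqP /setP/(_ u)].
by rewrite !inE eqxx.
Qed.

End Slides.

(** * The triangular grid of states and the rays through it *)

Section AugmentingPath.

Variables (V1 V2 : finType) (I J : {set V1 * V2}).
Variables (m : nat) (x : nat -> V1) (y : nat -> V2).
Hypotheses (x_inj : {in [pred i | (i <= m)%N] &, injective x})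
           (y_inj : {in [pred i | (i <= m)%N] &, injective y}).
Hypotheses (I_near : I \in near_perfect (x 0%N) (y m))
           (J_perfect : J \in perfect V1 V2).
Hypotheses (xy_notin : forall i, (i <= m)%N -> (x i, y i) \notin I)
           (xSy_in : forall i, (i < m)%N -> (x i.+1, y i) \in I).
Hypothesis symdiffE :
  symdiff I J = [set (x i, y i) | i : 'I_m.+1] :|: [set (x i.+1, y i) | i : 'I_m].

(* For [a <= b <= m], the near-perfect matching that agrees with J on the path
   before [x a] and after [y b], and with I in between and off the path. *)
Definition state (a b : nat) : {set V1 * V2} :=
  [set e in I | ~~ [exists i : 'I_m,
                      (e == (x i.+1, y i)) && ((i < a) || (b <= i))%N]]
  :|: [set (x i, y i) | i : 'I_m.+1 & ((i < a) || (b < i))%N].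

(** The case analysis by which equalities between states are checked edge by edge. *)
Variant edge_spec : V1 * V2 -> Prop :=
| EdgeJ i of (i <= m)%N : edge_spec (x i, y i)
| EdgeI i of (i < m)%N : edge_spec (x i.+1, y i)
| EdgeOff e of (forall i, (i <= m)%N -> e <> (x i, y i))
            & (forall i, (i < m)%N -> e <> (x i.+1, y i)) : edge_spec e.

Lemma edgeP e : edge_spec e.
Proof.
case: (boolP [exists i : 'I_m.+1, e == (x i, y i)]) => [/existsP[i /eqP ->]|noJ].
  by constructor; rewrite -ltnS.
case: (boolP [exists i : 'I_m, e == (x i.+1, y i)]) => [/existsP[i /eqP ->]|noI].
  by constructor.
constructor => i lt_i E.
  by case/existsP: noJ; exists (Ordinal (lt_i : (i < m.+1)%N)); rewrite E.
by case/existsP: noI; exists (Ordinal lt_i); rewrite E.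
Qed.

Lemma eq_edgeJ i j : (i <= m)%N -> (j <= m)%N ->
  ((x i, y i) == (x j, y j)) = (i == j).
Proof. by move=> li lj; apply/eqP/eqP => [[/x_inj->]|->]. Qed.

Lemma eq_edgeI i j : (i < m)%N -> (j < m)%N ->
  ((x i.+1, y i) == (x j.+1, y j)) = (i == j).
Proof.
move=> li lj; apply/eqP/eqP => [[_ /y_inj->] //|-> //]; rewrite inE; exact: ltnW.
Qed.

(** Equality would force [i = j] on the second side but [i = j.+1] on the first. *)
Lemma neq_edgeJI i j : (i <= m)%N -> (j < m)%N ->
  ((x i, y i) == (x j.+1, y j)) = false.
Proof.
move=> li lj; apply/eqP => -[Ex /y_inj Ey].
have Eij : i = j by apply: Ey; rewrite inE // ltnW.
have := @x_inj i j.+1 li lj Ex; lia.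
Qed.

(** One membership rule for each case of [edge_spec], here and in the next two lemmas, reduces
    identities between states to arithmetic on indices. *)
Lemma state_edgeJ a b i : (i <= m)%N ->
  ((x i, y i) \in state a b) = (i < a)%N || (b < i)%N.
Proof.
move=> li; rewrite !inE (negPf (xy_notin li)) /=.
apply/imsetP/idP => [[j]|ok].
  rewrite inE => okj /eqP.
  by rewrite (eq_edgeJ li (ltn_ord j : (j <= m)%N)) => /eqP->.
by exists (Ordinal (li : (i < m.+1)%N)); rewrite ?inE.
Qed.

Lemma state_edgeI a b i : (i < m)%N ->
  ((x i.+1, y i) \in state a b) = (a <= i < b)%N.
Proof.
move=> li; rewrite !inE xSy_in //=.
have -> : ((x i.+1, y i) \in
    [set (x j, y j) | j : 'I_m.+1 & ((j < a) || (b < j))%N]) = false.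
  apply/imsetP => -[j _ /eqP]; rewrite eq_sym neq_edgeJI //; exact: (ltn_ord j).
rewrite orbF; have -> : (a <= i < b)%N = ~~ ((i < a) || (b <= i))%N by lia.
congr (~~ _); apply/existsP/idP => [[j /andP[]]|ok].
  by rewrite eq_edgeI // => /eqP->.
by exists (Ordinal li); rewrite eqxx.
Qed.

Lemma state_edgeOff a b e : (forall i, (i <= m)%N -> e <> (x i, y i)) ->
  (forall i, (i < m)%N -> e <> (x i.+1, y i)) -> (e \in state a b) = (e \in I).
Proof.
move=> noJ noI; rewrite !inE.
have -> : (e \in [set (x j, y j) | j : 'I_m.+1 & ((j < a) || (b < j))%N]) = false.
  by apply/imsetP => -[j _ /noJ]; apply; exact: (ltn_ord j).
rewrite orbF; have -> :
    [exists i : 'I_m, (e == (x i.+1, y i)) && ((i < a) || (b <= i))%N] = false.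
  by apply/existsP => -[j /andP[/eqP E _]]; exact: (noI j (ltn_ord j) E).
by rewrite andbT.
Qed.

Lemma state_start : state 0 m = I.
Proof.
apply/setP => e; case: (edgeP e) => [i li|i li|f fJ fI].
- by rewrite state_edgeJ // (negPf (xy_notin li)) ltn0 ltnNge li.
- by rewrite state_edgeI // xSy_in.
- by rewrite state_edgeOff.
Qed.

Lemma J_edgeJ i : (i <= m)%N -> (x i, y i) \in J.
Proof.
move=> li; have : (x i, y i) \in symdiff I J.
  rewrite symdiffE inE; apply/orP; left; apply/imsetP.
  by exists (Ordinal (li : (i < m.+1)%N)).
by rewrite !inE (negPf (xy_notin li)) andbF /=.
Qed.

Lemma J_edgeI i : (i < m)%N -> (x i.+1, y i) \notin J.
Proof.
move=> li; have : (x i.+1, y i) \in symdiff I J.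
  rewrite symdiffE inE; apply/orP; right; apply/imsetP.
  by exists (Ordinal li).
by rewrite !inE xSy_in //= andbT orbF.
Qed.

Lemma J_edgeOff e : (forall i, (i <= m)%N -> e <> (x i, y i)) ->
  (forall i, (i < m)%N -> e <> (x i.+1, y i)) -> (e \in J) = (e \in I).
Proof.
move=> noJ noI; have : e \notin symdiff I J.
  rewrite symdiffE inE negb_or; apply/andP; split; apply/imsetP => -[i _].
    by apply: noJ; exact: (ltn_ord i).
  exact: noI.
by rewrite !inE; case: (e \in I); case: (e \in J).
Qed.

(** When [a = b] no path edge of [I] survives, and only one path edge of [J] is missing. *)
Lemma state_end a : (a <= m)%N -> state a a = J :\ (x a, y a).
Proof.
move=> la; apply/setP => e; rewrite in_setD1.
case: (edgeP e) => [i li|i li|f fJ fI].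
- by rewrite state_edgeJ // J_edgeJ // eq_edgeJ // andbT; lia.
- by rewrite state_edgeI // (negPf (J_edgeI li)) andbF; lia.
- by rewrite state_edgeOff // J_edgeOff //; case: eqP => // /fJ; case.
Qed.

Lemma state_slide1 a b : (a < b <= m)%N ->
  state a.+1 b = (x a, y a) |: state a b :\ (x a.+1, y a).
Proof.
move=> ab; apply/setP => e; rewrite in_setU1 in_setD1.
case: (edgeP e) => [i li|i li|f fJ fI].
- by rewrite !state_edgeJ // eq_edgeJ ?neq_edgeJI //; lia.
- by rewrite !state_edgeI // eq_edgeI ?[_ == (x a, y a)]eq_sym ?neq_edgeJI //; lia.
- rewrite !state_edgeOff //; case: eqP => [/fJ|_]; first by lia.
  by case: eqP => [/fI|_ //]; lia.
Qed.

Lemma state_slide2 a b : (a <= b < m)%N ->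
  state a b = (x b.+1, y b.+1) |: state a b.+1 :\ (x b.+1, y b).
Proof.
move=> ab; apply/setP => e; rewrite in_setU1 in_setD1.
case: (edgeP e) => [i li|i li|f fJ fI].
- by rewrite !state_edgeJ // eq_edgeJ ?neq_edgeJI //; lia.
- rewrite !state_edgeI // eq_edgeI ?[_ == (x b.+1, y b.+1)]eq_sym; try lia.
  by rewrite neq_edgeJI //; lia.
- rewrite !state_edgeOff //; case: eqP => [/fJ|_]; first by lia.
  by case: eqP => [/fI|_ //]; lia.
Qed.

(** Slides propagate the claim from [state 0 m = I]: first right slides along [a = 0], then left
    slides by induction on [a]. *)
Lemma state_near_perfect a b : (a <= b <= m)%N ->
  state a b \in near_perfect (x a) (y b).
Proof.
elim: a b => [|a IHa] b ab; last first.
  rewrite state_slide1; last by lia.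
  by apply: near_perfect_slide1; [apply: IHa; lia | rewrite state_edgeI; lia].
have [d] : exists d, b = (m - d)%N by exists (m - b)%N; lia.
elim: d b ab => [|d IHd] b ab Eb; first by rewrite Eb subn0 state_start.
(* If [m <= d], truncated subtraction makes [m - d.+1] and [m - d] both 0, and the induction
   hypothesis applies to the same [b]. *)
have [le_md|lt_dm] := leqP m d; first by apply: IHd; lia.
rewrite state_slide2; last by lia.
by apply: near_perfect_slide2; [apply: IHd; lia | rewrite state_edgeI; lia].
Qed.

Lemma adjacent_state1 a b : (a < b <= m)%N -> adjacent (state a b) (state a.+1 b).
Proof.
move=> ab; rewrite (state_slide1 ab); apply: (@adjacent_slide1 _ _ _ (x a) (y b)).
  by apply: state_near_perfect; lia.
by rewrite state_edgeI; lia.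
Qed.

Lemma adjacent_state2 a b : (a <= b < m)%N -> adjacent (state a b.+1) (state a b).
Proof.
move=> ab; rewrite (state_slide2 ab).
apply: (@adjacent_slide2 _ _ _ (x a) (y b.+1)).
  by apply: state_near_perfect; lia.
by rewrite state_edgeI; lia.
Qed.

(* When [m = 0] the quotient is [0], which is the right value. *)
Definition ray (c t : nat) : {set V1 * V2} :=
  if (t <= m)%N then state (c * t %/ m) (m - (t - c * t %/ m)) else J.

(** The ray stays in the triangle: [c <= m] bounds the left slides by the [t] slides made, and for
    their number a the inequality a <= m - (t - a) amounts to [t <= m]. *)
Lemma ray_pos c t : (c <= m)%N -> (t <= m)%N ->
  (c * t %/ m <= t)%N && (c * t %/ m <= m - (t - c * t %/ m) <= m)%N.
Proof.
move=> cm tm; have [->|m_gt0] := posnP m; first by rewrite divn0; lia.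
have : (c * t %/ m <= t)%N.
  by rewrite -[leqRHS](mulnK t m_gt0) leq_div2r // mulnC leq_mul2l cm orbT.
by lia.
Qed.

Lemma ray_start c : ray c 0 = I.
Proof. by rewrite /ray muln0 div0n !subn0 state_start. Qed.

Lemma ray_end c : ray c m.+1 = J.
Proof. by rewrite /ray ltnn. Qed.

Lemma ray_adjacent c t : (c <= m)%N -> (t < m.+1)%N ->
  adjacent (ray c t) (ray c t.+1).
Proof.
rewrite ltnS => cm tm; rewrite {1}/ray tm.
have pos := ray_pos cm tm.
rewrite /ray; case: ifP => [lt_tm|ge_tm]; last first.
  (* Here [t = m]: the ray has reached the diagonal, and the last step adds the missing edge of
     [J]. *)
  have -> : (m - (t - c * t %/ m) = c * t %/ m)%N.
    by clear -pos tm ge_tm; move: (c * t %/ m)%N pos => a pos; lia.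
  have am : (c * t %/ m <= m)%N by have /andP[_ /andP[]] := pos; exact: leq_trans.
  rewrite state_end //.
  apply: (@adjacent_add _ _ _ (x (c * t %/ m)) (y (c * t %/ m))) => //.
    exact: J_edgeJ.
  by rewrite -state_end // state_near_perfect // leqnn.
have m_gt0 : (0 < m)%N by lia.
have pos' := ray_pos cm lt_tm.
(* As [c <= m], the quotient grows by at most one per time step: no growth is a right slide, growth
   a left slide. *)
have [E|E] : (c * t.+1 %/ m = c * t %/ m \/ c * t.+1 %/ m = (c * t %/ m).+1)%N.
  have le1 : (c * t %/ m <= c * t.+1 %/ m)%N by apply: leq_div2r; lia.
  have le2 : (c * t.+1 %/ m <= (c * t + m) %/ m)%N by apply: leq_div2r; lia.
  by rewrite divnDr // divnn m_gt0 in le2; lia.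
- move: pos'; rewrite {}E => pos'; move: (c * t %/ m)%N pos pos' => a pos pos'.
  have -> : (m - (t - a) = (m - (t.+1 - a)).+1)%N by lia.
  by apply: adjacent_state2; lia.
- move: pos'; rewrite {}E => pos'; move: (c * t %/ m)%N pos pos' => a pos pos'.
  rewrite subSS.
  by apply: adjacent_state1; lia.
Qed.

(** The unmatched vertices determine a and b, hence the time a + (m - b), while [J] is set apart by
    being perfect. The quotient is recovered too, in order to count the rays through a state. *)
Lemma ray_inj c c' t t' :
  (c <= m)%N -> (c' <= m)%N -> (t <= m.+1)%N -> (t' <= m.+1)%N ->
  ray c t = ray c' t' -> t = t' /\ ((t <= m)%N -> c * t %/ m = c' * t' %/ m)%N.
Proof.
move=> cm c'm; rewrite /ray.
case: (leqP t m) => tm; case: (leqP t' m) => t'm le_t le_t' E; last 1 first.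
- by split; lia.
- have pos := ray_pos cm tm; have pos' := ray_pos c'm t'm.
  have /andP[_ /state_near_perfect NP] := pos.
  have /andP[_ /state_near_perfect] := pos'.
  rewrite -E => /(near_perfect_inj NP)[/x_inj Ea /y_inj Eb].
  move: pos pos' Ea Eb {E NP}; move: (c * t %/ m)%N (c' * t' %/ m)%N.
  move=> a a' pos pos' Ea Eb.
  have {}Ea : a = a' by apply: Ea; rewrite inE; lia.
  have {}Eb : (m - (t - a) = m - (t' - a'))%N by apply: Eb; rewrite inE; lia.
  by split=> //; lia.
- have /andP[_ /state_near_perfect/near_perfect_not_perfect] := ray_pos cm tm.
  by rewrite E J_perfect.
- have /andP[_ /state_near_perfect/near_perfect_not_perfect] := ray_pos c'm t'm.
  by rewrite -E J_perfect.
Qed.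

Lemma augmenting_path_routing (R : realType) :
  exists theta : {ffun spath I J -> R},
    is_routing theta /\ energy theta <= 1 + 6 * ln m.+1%:R.
Proof.
pose s (c : 'I_m.+1) t := ray c t.
have cm (c : 'I_m.+1) : (c <= m)%N by rewrite -ltnS.
have s0 c : s c 0%N = I by exact: ray_start.
have sL c : s c m.+1 = J by exact: ray_end.
have s_adj c t : (t < m.+1)%N -> adjacent (s c t) (s c t.+1) by exact: ray_adjacent.
have s_layer c c' t t' :
    (t <= m.+1)%N -> (t' <= m.+1)%N -> s c t = s c' t' -> t = t'.
  by move=> lt lt' /ray_inj[].
exists (uniform_routing R s0 sL s_adj s_layer); split.
  exact: uniform_routing_is_routing.
(* All rays start at [I], so time 0 gets the trivial bound 1. *)
pose b t : R := if t is t'.+1 then 3 * (t'.+1%:R)^-1 else 1.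
apply: (@le_trans _ _ (\sum_(t < m.+1) b t)).
  apply: energy_uniform_routing => c [|t] lt_t.
    by rewrite mul1r ler_nat -[leqRHS]card_ord max_card.
  rewrite /b mulrAC ler_pdivlMr ?ltr0n // -!natrM ler_nat.
  have := @card_divn_fiber m t.+1 (c * t.+1 %/ m) lt_t.
  set A := [set _ | _]; set B := [set _ | _] => leB.
  (* Rays meeting in a state at time [t.+1] share the quotient, so the fiber bound controls their
     number. *)
  have subAB : A \subset B.
    apply/subsetP => c'; rewrite !inE => /eqP /ray_inj[]//; try by rewrite ltnW.
    by move=> _ ->.
  have := subset_leq_card subAB; nia.
rewrite big_ord_recl lerD2l /=.
rewrite -mulr_sumr; have := sum_inv_le_ln R m; lra.
Qed.

End AugmentingPath.

(** * The universal constant *)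

Theorem lemma24 (R : realType) :
  exists C : R, 0 < C /\
    forall (n : nat) (V1 V2 : finType) (u : V1) (v : V2)
           (I J : {set V1 * V2}) (k : nat),
      #|V1| = n -> #|V2| = n ->
      I \in near_perfect u v -> J \in perfect V1 V2 ->
      augmenting_path I (symdiff I J) u v ->
      #|symdiff I J :&: I| = k -> #|symdiff I J :&: J| = k.+1 ->
      exists theta : {ffun spath I J -> R},
        is_routing theta /\ energy theta <= C * ln (k + 2)%:R.
Proof.
have ln2 : 0 < ln 2 :> R by rewrite ln_gt0 // ltr1n.
(* The first summand pays for the additive 1, since [ln (k + 2)%:R] is at least [ln 2]; the second
   pays for [6 * ln m.+1%:R], since [m <= k]. *)
exists ((ln 2)^-1 + 6); split; first by rewrite addr_gt0 ?invr_gt0.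
move=> n V1 V2 u v I J k _ _ I_near J_perfect.
move=> [m [x [y [x_inj y_inj [def_u def_v] _ [xy_notin xSy_in sdE]]]]] def_k _.
(* The edges [(x i.+1, y i)] are [m] distinct elements of the set counted by [k]. *)
have le_mk : (m <= k)%N.
  have inj_e : injective (fun i : 'I_m => (x i.+1, y i)).
    move=> i j /eqP; rewrite (eq_edgeI x y_inj) // => /eqP; exact: val_inj.
  rewrite -def_k -[leqLHS]card_ord -(card_imset _ inj_e) subset_leq_card //.
  apply/subsetP => e /imsetP[i _ ->]; rewrite in_setI xSy_in // andbT sdE.
  by rewrite in_setU orbC imset_f.
rewrite -def_u -def_v in I_near.
have [theta [th_routing th_energy]] :=
  augmenting_path_routing x_inj y_inj I_near J_perfect xy_notin xSy_in sdE R.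
exists theta; split => //; apply: le_trans th_energy _.
rewrite [leRHS]mulrDl; apply: lerD.
  by rewrite mulrC ler_pdivlMr // mul1r ler_ln ?posrE ?ltr0n ?ler_nat; lia.
by rewrite ler_pM2l ?ltr0n // ler_ln ?posrE ?ltr0n ?ler_nat; lia.
Qed.
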